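(* As formal power series in $z$, $$\sum_{n\ge 0} A_n(\mathbf{u},f,g,h,t\,|\,\alpha,\beta\,;\,p,q)\,z^n=\mathcal{J}(z;\mathbf{b},\boldsymbol{\lambda}),$$ where $$b_k=h^k\Bigl(u_3[\,k+1;1,\alpha t\,]_{p,q}+u_4[\,k+1;\beta t,1\,]_{p,q}\Bigr)\quad(k\ge 0),$$ $$\lambda_k=u_1u_2\,h^{2k-1}\,[\,k\,]_{p,q}\,[\,k+1;\beta g,\alpha f\,]_{p,q}\quad(k\ge 1).$$
   Context: $\mathfrak{S}_N$ is the set of permutations $\sigma=\sigma_1\cdots\sigma_N$ of $[N]=\{1,\dots,N\}$, written as words. With the convention $\sigma_0=\sigma_{N+1}=0$, a letter $\sigma_i$ ($i\in[N]$) is a valley if $\sigma_{i-1}>\sigma_i<\sigma_{i+1}$, a peak if $\sigma_{i-1}<\sigma_i>\sigma_{i+1}$, a double ascent if $\sigma_{i-1}<\sigma_i<\sigma_{i+1}$, a double descent if $\sigma_{i-1}>\sigma_i>\sigma_{i+1}$. Let $\mathrm{Val}(\sigma),\mathrm{Pk}(\sigma)$ be the sets of letters that are valleys, peaks, and let $\mathrm{val},\mathrm{pk},\mathrm{da},\mathrm{dd}$ be the numbers of valleys, peaks, double ascents, double descents. A letter $\sigma_i$ is a left-to-right maximum if $\sigma_i>\sigma_j$ for all $j<i$, and a right-to-left maximum if $\sigma_i>\sigma_j$ for all $j>i$; $\mathrm{lmax},\mathrm{rmax}$ count these. $\mathrm{lmaxpk}$ (resp. $\mathrm{rmaxpk}$)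 counts letters that are both a left-to-right (resp. right-to-left) maximum and a peak; $\mathrm{lmaxda}$ counts letters that are both a left-to-right maximum and a double ascent; $\mathrm{rmaxdd}$ counts letters that are both a right-to-left maximum and a double descent. For $\sigma\in\mathfrak{S}_N$, $$\mathrm{D}(\sigma)=\sum_{i\in \mathrm{Pk}(\sigma)\setminus\{N\}} i-\sum_{j\in\mathrm{Val}(\sigma)} j .$$ $(31\!-\!2)(\sigma)$ is the number of pairs $i<j$ with $\sigma_i>\sigma_j>\sigma_{i+1}$, $j\le N$; $(2\!-\!13)(\sigma)$ is the number of pairs $i<j<N$ with $\sigma_j<\sigma_i<\sigma_{j+1}$. With $\mathbf{u}=(u_1,u_2,u_3,u_4)$ and indeterminates $f,g,h,t,\alpha,\beta,p,q$, set $$A_n(\mathbf{u},f,g,h,t\,|\,\alpha,\beta\,;\,p,q)=\sum_{\sigma\in\mathfrak{S}_{n+1}}\mathrm{wt}(\sigma)\,h^{\mathrm{D}(\sigma)}p^{(31-2)(\sigma)}q^{(2-13)(\sigma)},$$ $$\mathrm{wt}(\sigma)=(u_1u_2)^{\mathrm{val}(\sigma)}u_3^{\mathrm{da}(\sigma)}u_4^{\mathrm{dd}(\sigma)}\alpha^{\mathrm{lmax}(\sigma)-1}\beta^{\mathrm{rmax}(\sigma)-1}f^{\mathrm{lmaxpk}(\sigma)-1}g^{\mathrm{rmaxpk}(\sigma)-1}t^{\mathrm{lmaxda}(\sigma)+\mathrm{rmaxdd}(\sigma)}.$$ For $k\ge 1$ and any $a,b$: $[\,k;a,b\,]_{p,q}=(a-1)p^{k-1}+(b-1)q^{k-1}+\frac{p^k-q^k}{p-q}$,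 and $[\,k\,]_{p,q}=[\,k;1,1\,]_{p,q}=\frac{p^k-q^k}{p-q}$. For sequences $\mathbf{b}=(b_k)_{k\ge0}$, $\boldsymbol{\lambda}=(\lambda_k)_{k\ge1}$ in a commutative ring, $\mathcal{J}(z;\mathbf{b},\boldsymbol{\lambda})$ is the formal power series $$\mathcal{J}(z;\mathbf{b},\boldsymbol{\lambda})=\cfrac{1}{1-b_0z-\cfrac{\lambda_1z^2}{1-b_1z-\cfrac{\lambda_2z^2}{1-b_2z-\ddots}}}.$$ *)

(* Defs.v *)
From HB Require Import structures.
From mathcomp Require Import all_boot all_order all_algebra all_fingroup.
From mathcomp Require Import zify ring.

Set Implicit Arguments.
Unset Strict Implicit.
Unset Printing Implicit Defensive.

Import Order.TTheory GRing.Theory Num.Theory.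

Local Open Scope nat_scope.

(* A permutation s of 'I_N is read as the word of the letters                 *)
(* letter s i = (s (i - 1)) + 1 for 1 <= i <= N; both positions and letters   *)
(* are numbered from 1, and letter s 0 = letter s N.+1 = 0.                   *)
Definition letter (N : nat) (s : 'S_N) (i : nat) : nat :=
  if i is j.+1 then oapp (fun k : 'I_N => (s k).+1) 0 (insub j) else 0.

Definition is_valley (N : nat) (s : 'S_N) (i : nat) : bool :=
  (letter s i.-1 > letter s i) && (letter s i < letter s i.+1).
Definition is_peak (N : nat) (s : 'S_N) (i : nat) : bool :=
  (letter s i.-1 < letter s i) && (letter s i > letter s i.+1).
Definition is_dasc (N : nat) (s : 'S_N) (i : nat) : bool :=
  letter s i.-1 < letter s i < letter s i.+1.
Definition is_ddes (N : nat) (s : 'S_N) (i : nat) : bool :=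
  (letter s i.-1 > letter s i) && (letter s i > letter s i.+1).
Definition is_lmax (N : nat) (s : 'S_N) (i : nat) : bool :=
  all (fun j => letter s i > letter s j) (index_iota 1 i).
Definition is_rmax (N : nat) (s : 'S_N) (i : nat) : bool :=
  all (fun j => letter s i > letter s j) (index_iota i.+1 N.+1).

(* Letters being distinct, letters with a property are counted by position.   *)
Definition npos (N : nat) (P : pred nat) : nat := count P (index_iota 1 N.+1).

Definition val_stat (N : nat) (s : 'S_N) := npos N (is_valley s).
Definition da_stat (N : nat) (s : 'S_N) := npos N (is_dasc s).
Definition dd_stat (N : nat) (s : 'S_N) := npos N (is_ddes s).
Definition lmax_stat (N : nat) (s : 'S_N) := npos N (is_lmax s).
Definition rmax_stat (N : nat) (s : 'S_N) := npos N (is_rmax s).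
Definition lmaxpk_stat (N : nat) (s : 'S_N) :=
  npos N (predI (is_lmax s) (is_peak s)).
Definition rmaxpk_stat (N : nat) (s : 'S_N) :=
  npos N (predI (is_rmax s) (is_peak s)).
Definition lmaxda_stat (N : nat) (s : 'S_N) :=
  npos N (predI (is_lmax s) (is_dasc s)).
Definition rmaxdd_stat (N : nat) (s : 'S_N) :=
  npos N (predI (is_rmax s) (is_ddes s)).

Definition D_stat (N : nat) (s : 'S_N) : int :=
  (\sum_(1 <= i < N.+1 | is_peak s i && (letter s i != N)) (letter s i)%:Z
   - \sum_(1 <= i < N.+1 | is_valley s i) (letter s i)%:Z)%R.

Definition stat_31_2 (N : nat) (s : 'S_N) : nat :=
  \sum_(1 <= i < N.+1) \sum_(i.+1 <= j < N.+1)
    ((letter s i > letter s j) && (letter s j > letter s i.+1)).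
Definition stat_2_13 (N : nat) (s : 'S_N) : nat :=
  \sum_(1 <= j < N) \sum_(1 <= i < j) (letter s j < letter s i < letter s j.+1).

Lemma letterE (N : nat) (s : 'S_N) (k : 'I_N) : letter s k.+1 = (s k).+1.
Proof. by rewrite /letter valK. Qed.

Lemma letter_out (N : nat) (s : 'S_N) : letter s N.+1 = 0.
Proof. by rewrite /letter insubF // ltnn. Qed.

Lemma letter_le (N : nat) (s : 'S_N) (i : nat) : letter s i <= N.
Proof. by case: i => //= j; case: insubP => //= k _ _; apply: ltn_ord. Qed.

Lemma letter_inj (N : nat) (s : 'S_N) (i j : nat) :
  0 < letter s i -> letter s i = letter s j -> i = j.
Proof.
case: i => //= i; case: insubP => //= k _ <- _; case: j => //= j.
by case: insubP => //= l _ <- [] /val_inj /perm_inj ->.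
Qed.

Lemma letter_max_ex (n : nat) (s : 'S_n.+1) :
  exists i, [/\ 1 <= i, i < n.+2 & letter s i = n.+1].
Proof.
exists ((s^-1)%g ord_max).+1; split => //; first by rewrite ltnS ltn_ord.
by rewrite letterE permKV.
Qed.

Lemma letter_lt_max (n : nat) (s : 'S_n.+1) (i j : nat) :
  letter s i = n.+1 -> j != i -> letter s j < letter s i.
Proof.
move=> si nij; rewrite ltn_neqAle {2}si letter_le andbT.
by apply: contraNN nij => /eqP e; rewrite (letter_inj _ e) // e si.
Qed.

Lemma letter_max_peak (n : nat) (s : 'S_n.+1) (i : nat) :
  1 <= i -> letter s i = n.+1 -> [&& is_peak s i, is_lmax s i & is_rmax s i].
Proof.
move=> i0 si; apply/and3P; split.
- by rewrite /is_peak !letter_lt_max //; lia.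
- by apply/allP => j; rewrite mem_index_iota => ji; apply: letter_lt_max => //; lia.
- by apply/allP => j; rewrite mem_index_iota => ji; apply: letter_lt_max => //; lia.
Qed.

(* The exponents "statistic - 1" and D of the weight below are natural        *)
(* numbers, so neither .-1 nor the absolute value distorts them.              *)
Lemma lmaxpk_gt0 (n : nat) (s : 'S_n.+1) : 0 < lmaxpk_stat s.
Proof.
have [i [i0 iN si]] := letter_max_ex s.
rewrite /lmaxpk_stat /npos -has_count; apply/hasP; exists i => /=.
  by rewrite mem_index_iota i0.
by case/and3P: (letter_max_peak i0 si) => -> ->.
Qed.

Lemma rmaxpk_gt0 (n : nat) (s : 'S_n.+1) : 0 < rmaxpk_stat s.
Proof.
have [i [i0 iN si]] := letter_max_ex s.
rewrite /rmaxpk_stat /npos -has_count; apply/hasP; exists i => /=.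
  by rewrite mem_index_iota i0.
by case/and3P: (letter_max_peak i0 si) => -> _ ->.
Qed.

Lemma lmax_gt0 (n : nat) (s : 'S_n.+1) : 0 < lmax_stat s.
Proof.
by apply: leq_trans (lmaxpk_gt0 s) _; apply: sub_count => i /= /andP[].
Qed.

Lemma rmax_gt0 (n : nat) (s : 'S_n.+1) : 0 < rmax_stat s.
Proof.
by apply: leq_trans (rmaxpk_gt0 s) _; apply: sub_count => i /= /andP[].
Qed.

(* Sum of peaks - sum of valleys = total height of the ascents. *)
Lemma D_stat_ge0 (n : nat) (s : 'S_n.+1) : (0 <= D_stat s)%R.
Proof.
have [m [m0 mN sm]] := letter_max_ex s.
case/and3P: (letter_max_peak m0 sm) => pm _ _.
pose w i : int := Posz (letter s i).
pose a i : int := Posz (letter s i < letter s i.+1).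
have abel k : (\sum_(1 <= i < k.+1) w i * (a i.-1 - a i)
   = \sum_(0 <= i < k) a i * (w i.+1 - w i) - a k * w k)%R.
  elim: k => [|k IH]; first by rewrite !big_geq // /w /= mulr0 subr0.
  by rewrite big_nat_recr //= IH [in RHS]big_nat_recr //=; ring.
have pv : (\sum_(1 <= i < n.+2 | is_peak s i) w i
   - \sum_(1 <= i < n.+2 | is_valley s i) w i
   = \sum_(1 <= i < n.+2) w i * (a i.-1 - a i))%R.
  rewrite big_mkcond [X in (_ - X)%R]big_mkcond -sumrB /=.
  apply: eq_big_nat => -[//|i] /andP[_ iN].
  rewrite /is_peak /is_valley /a /w /=.
  have pos : 0 < letter s i.+1.
    by have := letterE s (Ordinal (iN : i < n.+1)) => /= ->.
  have d1 : letter s i != letter s i.+1.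
    by apply/eqP => e; have := letter_inj pos (esym e); lia.
  have d2 : letter s i.+1 != letter s i.+2.
    by apply/eqP => e; have := letter_inj pos e; lia.
  by case: ltngtP d1 => // _ _; case: ltngtP d2 => // _ _ /=; ring.
have pN : (\sum_(1 <= i < n.+2 | is_peak s i) w i
   = n.+1%:Z + \sum_(1 <= i < n.+2 | is_peak s i && (letter s i != n.+1)) w i)%R.
  rewrite (bigID (fun i => letter s i == n.+1)) /=; congr (_ + _)%R.
  rewrite (eq_bigl (pred1 m)) => [|i].
    by rewrite big_nat1_eq m0 mN /w sm.
  apply/andP/eqP => [[_ /eqP si]|->]; last by rewrite pm sm.
  by apply: (@letter_inj _ s) => //; rewrite si.
have -> : D_stat s = (\sum_(0 <= i < n.+1) a i * (w i.+1 - w i) - n.+1%:Z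
    - a n.+1 * w n.+1)%R.
  transitivity (\sum_(1 <= i < n.+2) w i * (a i.-1 - a i) - n.+1%:Z)%R.
    by rewrite -pv pN /D_stat /w; ring.
  by rewrite abel; ring.
have -> : a n.+1 = 0%R by rewrite /a letter_out.
rewrite mul0r subr0 subr_ge0 (big_cat_nat _ (n := m)) //=.
have up i : (w i.+1 - w i <= a i * (w i.+1 - w i))%R by rewrite /a /w; lia.
have up0 i : (0 <= a i * (w i.+1 - w i))%R by rewrite /a /w; lia.
have <- : (\sum_(0 <= i < m) (w i.+1 - w i) = n.+1%:Z)%R.
  by rewrite telescope_sumr // /w sm /= subr0.
by rewrite -[leLHS]addr0 lerD ?ler_sum ?sumr_ge0.
Qed.

Local Open Scope ring_scope.

(* The exact quotient (p^k - q^k) / (p - q), see pqintM and pqintE. *)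
Definition pqint (R : comNzRingType) (k : nat) (p q : R) : R :=
  \sum_(i < k) p ^+ (k.-1 - i) * q ^+ i.

Definition pqint3 (R : comNzRingType) (k : nat) (a b p q : R) : R :=
  (a - 1) * p ^+ k.-1 + (b - 1) * q ^+ k.-1 + pqint k p q.

Lemma pqintM (R : comNzRingType) (k : nat) (p q : R) :
  (p - q) * pqint k p q = p ^+ k - q ^+ k.
Proof. by rewrite subrXX; congr (_ * _); apply: eq_bigr => i _; congr (_ ^+ _ * _); lia. Qed.

Lemma pqintE (F : fieldType) (k : nat) (p q : F) :
  p != q -> pqint k p q = (p ^+ k - q ^+ k) / (p - q).
Proof. by move=> npq; rewrite -pqintM mulrC mulKf // subr_eq0. Qed.

Lemma pqint3_11 (R : comNzRingType) (k : nat) (p q : R) :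
  pqint3 k 1 1 p q = pqint k p q.
Proof. by rewrite /pqint3 subrr !mul0r !add0r. Qed.

Definition A_poly (R : comNzRingType) (u1 u2 u3 u4 f g h t alpha beta p q : R)
    (n : nat) : R :=
  \sum_(s : 'S_n.+1)
    (u1 * u2) ^+ val_stat s * u3 ^+ da_stat s * u4 ^+ dd_stat s
    * alpha ^+ (lmax_stat s).-1 * beta ^+ (rmax_stat s).-1
    * f ^+ (lmaxpk_stat s).-1 * g ^+ (rmaxpk_stat s).-1
    * t ^+ (lmaxda_stat s + rmaxdd_stat s)
    * h ^+ `|D_stat s|%N * p ^+ stat_31_2 s * q ^+ stat_2_13 s.

(* A formal power series is its sequence of coefficients. *)
Definition fps (R : Type) : Type := nat -> R.

Definition fps1 (R : comNzRingType) : fps R := fun n => (n == 0%N)%:R.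
Definition fps_sub (R : comNzRingType) (F G : fps R) : fps R :=
  fun n => F n - G n.
Definition fps_mul (R : comNzRingType) (F G : fps R) : fps R :=
  fun n => \sum_(i < n.+1) F i * G (n - i)%N.
Definition fps_exp (R : comNzRingType) (F : fps R) (j : nat) : fps R :=
  iter j (fps_mul F) (fps1 R).

(* Inverse of a series with constant term 1: 1 / F = \sum_j (1 - F)^j, where  *)
(* only the terms j <= n contribute to the coefficient of z^n.                *)
Definition fps_inv (R : comNzRingType) (F : fps R) : fps R :=
  fun n => \sum_(j < n.+1) fps_exp (fps_sub (fps1 R) F) j n.

(* 1 - c z - l z^2 F(z) *)
Definition jden (R : comNzRingType) (c l : R) (F : fps R) : fps R :=
  fun n => match n with 0 => 1 | 1 => - c | i.+2 => - (l * F i) end.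

(* The continued fraction started at level k and cut off after m levels. *)
Fixpoint jconv (R : comNzRingType) (b lam : nat -> R) (m k : nat) : fps R :=
  if m is m'.+1 then fps_inv (jden (b k) (lam k.+1) (jconv b lam m' k.+1))
  else fun=> 0.

(* The z-adic limit of the truncations, which have stabilised at z^n once     *)
(* m > n (jconv_stable). The value lam 0 is not used.                         *)
Definition Jfrac (R : comNzRingType) (b lam : nat -> R) : fps R :=
  fun n => jconv b lam n.+1 0 n.

Lemma fps_mul_eq (R : comNzRingType) (F F' G G' : fps R) (n : nat) :
  (forall i, (i <= n)%N -> F i = F' i) -> (forall i, (i <= n)%N -> G i = G' i) ->
  fps_mul F G n = fps_mul F' G' n.
Proof.
move=> eF eG; apply: eq_bigr => i _.
by rewrite eF ?eG ?leq_subr // -ltnS.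
Qed.

Lemma fps_exp_eq (R : comNzRingType) (F F' : fps R) (j n : nat) :
  (forall i, (i <= n)%N -> F i = F' i) -> fps_exp F j n = fps_exp F' j n.
Proof.
elim: j n => //= j IH n eF; apply: fps_mul_eq => // i le_in.
by apply: IH => k le_ki; apply: eF; apply: leq_trans le_in.
Qed.

Lemma fps_inv_eq (R : comNzRingType) (F F' : fps R) (n : nat) :
  (forall i, (i <= n)%N -> F i = F' i) -> fps_inv F n = fps_inv F' n.
Proof.
by move=> eF; apply: eq_bigr => j _; apply: fps_exp_eq => i /eF; rewrite /fps_sub => ->.
Qed.

Lemma fps_exp_low (R : comNzRingType) (F : fps R) (j n : nat) :
  F 0%N = 0 -> (n < j)%N -> fps_exp F j n = 0.
Proof.
move=> F0; elim: j n => //= j IH n ltnj; rewrite /fps_mul big1 // => -[[|i] lti] _ /=.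
  by rewrite F0 mul0r.
by rewrite -/(fps_exp F j) IH ?mulr0 //; lia.
Qed.

Lemma fps_mulV (R : comNzRingType) (F : fps R) :
  F 0%N = 1 -> fps_mul F (fps_inv F) =1 fps1 R.
Proof.
move=> F0 n; set X := fps_sub (fps1 R) F.
have X0 : X 0%N = 0 by rewrite /X /fps_sub /fps1 F0 subrr.
have FX i : F i = fps1 R i - X i by rewrite /X /fps_sub subKr.
have invE i : (i <= n)%N -> fps_inv F i = \sum_(j < n.+1) fps_exp X j i.
  move=> le_in; rewrite /fps_inv -/X.
  rewrite -(big_mkord xpredT (fun j => fps_exp X j i)).
  rewrite -(big_mkord xpredT (fun j => fps_exp X j i)).
  rewrite [RHS](big_cat_nat (n := i.+1)) //= [X in _ + X]big1_seq ?addr0 //.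
  by move=> j; rewrite mem_index_iota => /andP[_ /andP[ltij _]]; apply: fps_exp_low.
transitivity (\sum_(j < n.+1) (fps_exp X j n - fps_exp X j.+1 n)).
  rewrite (fps_mul_eq (F' := F) (G' := fun i => \sum_(j < n.+1) fps_exp X j i)) //.
  rewrite /fps_mul; under eq_bigr do rewrite mulr_sumr.
  rewrite exchange_big /=; apply: eq_bigr => j _.
  under eq_bigr do rewrite FX mulrBl.
  rewrite sumrB; congr (_ - _).
  rewrite big_ord_recl /= /fps1 eqxx mul1r subn0 big1 ?addr0 // => i _.
  by rewrite mul0r.
rewrite -(big_mkord xpredT (fun j => fps_exp X j n - fps_exp X j.+1 n)).
rewrite (eq_bigr (fun j => - fps_exp X j.+1 n - - fps_exp X j n)); last first.
  by move=> j _; rewrite opprK addrC.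
rewrite (telescope_sumr (fun j => - fps_exp X j n)) //.
by rewrite (fps_exp_low X0 (ltnSn n)) oppr0 add0r opprK.
Qed.

Lemma jconv_stable (R : comNzRingType) (b lam : nat -> R) (m k n : nat) :
  (n < m)%N -> jconv b lam m k n = jconv b lam n.+1 k n.
Proof.
elim: n {-2}n (leqnn n) m k => [|N IH] n leN [//|m] k ltnm /=;
  apply: fps_inv_eq => -[|[|i]] //= lein; first by lia.
by rewrite (IH i) ?[in RHS](IH i) //; lia.
Qed.

Lemma jconv_shift (R : comNzRingType) (b lam : nat -> R) (m k n : nat) :
  jconv b lam m k.+1 n = jconv (b \o S) (lam \o S) m k n.
Proof.
elim: m k n => //= m IH k n; apply: fps_inv_eq => -[|[|i]] //= _.
by rewrite IH.
Qed.

Lemma JfracE (R : comNzRingType) (b lam : nat -> R) :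
  fps_mul (jden (b 0%N) (lam 1%N) (Jfrac (b \o S) (lam \o S))) (Jfrac b lam)
    =1 fps1 R.
Proof.
move=> n; rewrite -(@fps_mulV _ (jden (b 0%N) (lam 1%N) (Jfrac (b \o S) (lam \o S)))) //.
apply: fps_mul_eq => // i _; apply: fps_inv_eq => -[|[|j]] //= ltji.
by rewrite -/(jconv b lam i 1) /Jfrac jconv_shift jconv_stable //; lia.
Qed.

(* Main.v *)
Require Import Defs.
From mathcomp Require Import all_boot all_order all_algebra all_fingroup.
From mathcomp Require Import zify ring.

Set Implicit Arguments.
Unset Strict Implicit.
Unset Printing Implicit Defensive.

Import GRing.Theory.
Local Open Scope ring_scope.

(** Call the letters larger than x that stand in consecutive positions a hole
    below threshold x.  Revealing the letters of a permutation in increasing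
    order turns the single hole of length N into nothing.  Suppose that k + 1
    holes are left just before x is revealed, and that x sits in one of them,
    with j holes to its left and k - j to its right.  What x leaves of its hole
    on its two sides tells its type: something on both sides for a valley, on
    the right only for a double ascent, on the left only for a double descent,
    nothing for a peak; so k changes by 1, 0, 0 or -1.  Each of the j holes on
    the left ends in a drop across x and each of the k - j on the right begins
    with a rise across x, so x is the letter 2 of j patterns 31-2 and of k - j
    patterns 2-13; x is a left-to-right maximum iff j = 0 and it leaves nothing
    on its left, and symmetrically on the right.  Finally D is the sum of these
    k over all letters, because the total height of the ascents counts the
    ascents across every letter.  Hence the weight of a permutation is a
    product of local weights [gap_wt] ([perm_wt_prod]).

    A permutation is the order in which positions are emptied, so A_n is a
    recursive sum over these orders ([A_polyE]), which depends on the lengths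
    of the holes only ([bit_sum_bits]).  Lengths are then summed away: over all
    compositions of the number of hidden letters into k + 1 hole lengths,
    revealing the next letter in the hole of rank j produces every composition
    with one letter less exactly once for each type ([comps_sum_split]).  The
    resulting totals only remember the number of letters and the number of
    holes, and they obey the recursion of weighted Motzkin paths
    ([filling_sum_rec]), in which the sum over j of p^j q^(k-j), corrected at
    j = 0 and j = k by the maxima, is the three-parameter (p,q)-integer
    ([gap_sum]).  The continued fraction of such paths is Flajolet's theorem
    ([Jfrac_paths]). *)

(** * Weighted Motzkin paths and J-fractions *)

Section Flajolet.

Variable R : comNzRingType.
Implicit Types F G H : fps R.

Definition fps_shift F : fps R := fun n => if n is m.+1 then F m else 0.

(** Cauchy products are products of truncated polynomials, from which they
    inherit commutativity and associativity. *)
Lemma fps_mul_coef F G (N n : nat) : (n < N)%N ->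
  fps_mul F G n = (\poly_(i < N) F i * \poly_(i < N) G i)`_n.
Proof.
move=> ltnN; rewrite coefM; apply: eq_bigr => i _.
by have lti := ltn_ord i; rewrite !coef_poly !ifT //; lia.
Qed.

Lemma fps_mulC F G : fps_mul F G =1 fps_mul G F.
Proof. by move=> n; rewrite !(fps_mul_coef _ _ (ltnSn n)) mulrC. Qed.

Lemma fps_mulA F G H : fps_mul F (fps_mul G H) =1 fps_mul (fps_mul F G) H.
Proof.
move=> n; have trunc (A B : fps R) : \poly_(i < n.+1) fps_mul A B i =
    \poly_(i < n.+1) (\poly_(i < n.+1) A i * \poly_(i < n.+1) B i)`_i.
  by apply/polyP => i; rewrite !coef_poly; case: ifP => // lti; exact: fps_mul_coef.
have mul_trunc (P Q : {poly R}) : (P * \poly_(i < n.+1) Q`_i)`_n = (P * Q)`_n.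
  rewrite !coefM; apply: eq_bigr => i _; by have lti := ltn_ord i; rewrite coef_poly ifT //; lia.
rewrite !(fps_mul_coef _ _ (ltnSn n)) !trunc mul_trunc.
by rewrite [in RHS]mulrC mul_trunc mulrA mulrC.
Qed.

Lemma fps_mul1 F : fps_mul F (fps1 R) =1 F.
Proof.
move=> n; rewrite /fps_mul big_ord_recr /= subnn /fps1 eqxx mulr1 big1 ?add0r // => i _.
by rewrite subn_eq0 leqNgt ltn_ord mulr0.
Qed.

Lemma fps_mul_shift F G :
  fps_mul F (fps_shift G) =1 fps_shift (fps_mul F G).
Proof.
move=> [|n]; rewrite /fps_mul /=; first by rewrite big_ord_recr big_ord0 /= mulr0 addr0.
rewrite big_ord_recr /= subnn mulr0 addr0.
by apply: eq_bigr => i _; rewrite subSn // -ltnS.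
Qed.

Lemma fps_mulDr F G H :
  fps_mul F (fun n => G n + H n) =1 (fun n => fps_mul F G n + fps_mul F H n).
Proof. by move=> n; rewrite -big_split; apply: eq_bigr => i _ /=; rewrite mulrDr. Qed.

Lemma fps_mulZr F (c : R) G :
  fps_mul F (fun n => c * G n) =1 (fun n => c * fps_mul F G n).
Proof. by move=> n; rewrite mulr_sumr; apply: eq_bigr => i _ /=; rewrite mulrCA. Qed.

Lemma eq_fps_mul F F' G G' : F =1 F' -> G =1 G' -> fps_mul F G =1 fps_mul F' G'.
Proof. by move=> eF eG n; apply: fps_mul_eq. Qed.

Definition seq_tail (b : nat -> R) (k : nat) : nat -> R := iter k (fun c => c \o S) b.

Lemma seq_tailE b k i : seq_tail b k i = b (i + k)%N.
Proof. by elim: k i => [|k IH] i; rewrite ?addn0 //= IH addSnnS. Qed.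

Definition Jtail (b lam : nat -> R) (k : nat) : fps R :=
  Jfrac (seq_tail b k) (seq_tail lam k).

(** The fixed-point form F = 1 + z (b F + lam z F F') of F = 1/(1 - b z - lam z^2 F'). *)
Lemma JtailE (b lam : nat -> R) k :
  Jtail b lam k =1 (fun n => fps1 R n + fps_shift (fun m => b k * Jtail b lam k m +
     lam k.+1 * fps_shift (fps_mul (Jtail b lam k) (Jtail b lam k.+1)) m) n).
Proof.
move=> n; have := JfracE (seq_tail b k) (seq_tail lam k) n.
rewrite !seq_tailE add0n add1n -/(Jtail b lam k) -[Jfrac _ _]/(Jtail b lam k.+1).
case: n => [|n]; rewrite {1}/fps_mul big_ord_recl /= mul1r.
  by rewrite big_ord0 !addr0.
move=> /(canRL (addrK _)) ->; rewrite big_ord_recl /= subSS subn0 opprD mulNr opprK.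
congr (_ + (_ + _)); case: n => [|n]; first by rewrite big_ord0 mulr0 oppr0.
rewrite [in RHS]/= fps_mulC -sumrN mulr_sumr; apply: eq_bigr => i _.
by rewrite /= /bump !add1n !subSS mulNr opprK mulrA.
Qed.

(** Weighted paths from level k to level 0 whose first step, if any, goes down:
    an arbitrary path begins with an excursion that stays at level k or higher,
    counted by [Jtail b lam k], and continues as one of these. *)
Fixpoint down_first (b lam L : nat -> R) (k : nat) : fps R :=
  if k is k'.+1 then
    fps_shift (fun m => L k * fps_mul (down_first b lam L k') (Jtail b lam k') m)
  else fps1 R.

(** Flajolet's theorem.  Here [mu n k] is the weight of the paths of n steps from
    level k to level 0; its generating function is the product of the tails of
    the fraction at levels 0, ..., k with the down-steps L between them, since
    this product satisfies the same recursion. *)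
Lemma Jfrac_paths (b lam V L : nat -> R) (mu : nat -> nat -> R) :
    (forall k, lam k.+1 = V k * L k.+1) ->
    (forall k, mu 0%N k = (k == 0%N)%:R) ->
    (forall n k, mu n.+1 k = V k * mu n k.+1 + b k * mu n k
                             + (if k is k'.+1 then L k * mu n k' else 0)) ->
  mu^~ 0%N =1 Jfrac b lam.
Proof.
move=> lamE mu0 muS.
pose Q := down_first b lam L; pose J := Jtail b lam.
have QJ n k : mu n k = fps_mul (Q k) (J k) n; last first.
  by move=> n; rewrite QJ fps_mulC fps_mul1.
elim: n k => [|n IH] k; rewrite (eq_fps_mul (frefl _) (JtailE b lam k)) fps_mulDr fps_mul1.
  by rewrite mu0 fps_mul_shift /= addr0 /Q; case: k => [|k] /=; rewrite /fps1.
rewrite fps_mul_shift /= fps_mulDr !fps_mulZr fps_mul_shift -/J muS !IH.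
(* The up-step V and the down-step L by which the path later comes back to level
   k merge into the factor lam k.+1. *)
have -> : V k * fps_mul (Q k.+1) (J k.+1) n =
    lam k.+1 * fps_shift (fps_mul (Q k) (fps_mul (J k) (J k.+1))) n.
  rewrite -[Q k.+1]/(fps_shift (fun m => L k.+1 * fps_mul (Q k) (J k) m)).
  rewrite fps_mulC fps_mul_shift lamE -mulrA; congr (_ * _).
  case: n {IH} => [|n]; first by rewrite mulr0.
  by rewrite /fps_shift fps_mulZr fps_mulC -fps_mulA.
have -> : Q k n.+1 = if k is k'.+1 then L k * mu n k' else 0.
  by case: k => [|k] //; rewrite IH.
by rewrite [LHS]addrC; congr (_ + _); rewrite addrC.
Qed.

End Flajolet.

(** * Cut sequences and compositions *)

Section Cuts.

Variable R : nmodType.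

(** The next letter is chosen by its hole, or by its position: both choices single
    out one entry of a sequence, and the local weight looks at the entries before
    it and after it. *)
Fixpoint cutsum (X : Type) (G : seq X -> X -> seq X -> R) (c : seq X) : R :=
  if c is x :: c' then G [::] x c' + cutsum (fun l => G (x :: l)) c' else 0.

Lemma eq_cutsum (X : Type) (G G' : seq X -> X -> seq X -> R) (c : seq X) :
  (forall l x r, c = l ++ x :: r -> G l x r = G' l x r) -> cutsum G c = cutsum G' c.
Proof.
elim: c G G' => //= x c IH G G' eG; congr (_ + _); first exact: (eG [::]).
by apply: IH => l y r e; apply: (eG (x :: l)); rewrite e.
Qed.

Lemma cutsum_cat (X : Type) (G : seq X -> X -> seq X -> R) (c d : seq X) :
  cutsum G (c ++ d) =
  cutsum (fun l x r => G l x (r ++ d)) c + cutsum (fun l x r => G (c ++ l) x r) d.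
Proof. by elim: c G => [|x c IH] G /=; rewrite ?add0r // IH addrA. Qed.

Lemma cutsumE (X : Type) (x0 : X) (G : seq X -> X -> seq X -> R) (c : seq X) :
  cutsum G c = \sum_(j < size c) G (take j c) (nth x0 c j) (drop j.+1 c).
Proof.
elim: c G => [|x c IH] G /=; first by rewrite big_ord0.
by rewrite big_ord_recl /= drop0 IH.
Qed.

Lemma sum_triangle (K : nat -> nat -> nat -> R) (n : nat) :
  \sum_(m < n.+1) \sum_(a < m.+1) K a (m - a)%N (n - m)%N =
  \sum_(a < n.+1) \sum_(b < (n - a).+1) K a b (n - a - b)%N.
Proof.
elim: n K => [|n IH] K; first by rewrite !big_ord_recl !big_ord0.
under eq_bigr do rewrite big_ord_recl.
rewrite big_split [in RHS]big_ord_recl /=; congr (_ + _).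
  by apply: eq_bigr => i _; rewrite subn0.
rewrite big_ord_recl big_ord0 add0r.
by rewrite -(IH (fun a => K a.+1)).
Qed.

End Cuts.

Section Compositions.

Variable R : comNzRingType.
Implicit Types F : seq nat -> R.

(** Sum of F over the compositions of n into k positive parts. *)
Fixpoint comps_sum (k n : nat) F : R :=
  if k is k'.+1 then \sum_(a < n) comps_sum k' (n - a.+1) (fun c => F (a.+1 :: c))
  else (n == 0%N)%:R * F [::].

Lemma eq_comps_sum k n F F' :
  (forall c, size c = k -> all (leq 1) c -> F c = F' c) -> comps_sum k n F = comps_sum k n F'.
Proof.
elim: k n F F' => [|k IH] n F F' eF /=; first by rewrite eF.
by apply: eq_bigr => a _; apply: IH => c sc pc; apply: eF; rewrite /= ?sc.
Qed.

Lemma comps_sum_sum k n m (F : 'I_m -> seq nat -> R) :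
  comps_sum k n (fun c => \sum_(j < m) F j c) = \sum_(j < m) comps_sum k n (F j).
Proof.
elim: k n F => [|k IH] n F /=; first by rewrite mulr_sumr.
under eq_bigr do rewrite IH; exact: exchange_big.
Qed.

Lemma comps_sumZ k n x F : comps_sum k n (fun c => x * F c) = x * comps_sum k n F.
Proof.
elim: k n F => [|k IH] n F /=; first by rewrite mulrCA.
by under eq_bigr do rewrite IH; rewrite mulr_sumr.
Qed.

Lemma comps_sum1 n F : comps_sum 1 n.+1 F = F [:: n.+1].
Proof.
rewrite /= big_ord_recr /= subnn mul1r big1 ?add0r // => a _.
by rewrite subn_eq0 ltnS leqNgt ltn_ord mul0r.
Qed.

(** A hole of length 0 is no hole: it disappears from the composition. *)
Definition nonzero_part (a : nat) : seq nat := if a is 0 then [::] else [:: a].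

Definition split_part (w : bool -> bool -> R) F (l : seq nat) (m : nat) (r : seq nat) : R :=
  \sum_(a < m) w (0 < a)%N (0 < m.-1 - a)%N *
    F (l ++ nonzero_part a ++ nonzero_part (m.-1 - a) ++ r).

(** Removing one element from part j of a composition of n leaves the rest of
    that part on the left and on the right of it.  The result runs once
    through the compositions of n - 1 into one part more if both remainders are
    nonempty, into as many parts if one is, and into one part less if none is. *)
Lemma comps_sum_split (w : bool -> bool -> R) F (j i n : nat) :
  comps_sum (j + i.+1) n (fun c => split_part w F (take j c) (nth 0%N c j) (drop j.+1 c)) =
  if n is n'.+1 then
    w true true * comps_sum (j + i.+2) n' F
    + (w false true + w true false) * comps_sum (j + i.+1) n' F
    + w false false * comps_sum (j + i) n' F
  else 0.
Proof.
elim: j n F => [|j IH] [|n] F; rewrite ?add0n ?addSn //=; try by rewrite big_ord0.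
  under eq_bigr do [rewrite subSS /split_part /= comps_sum_sum;
    under eq_bigr do [rewrite comps_sumZ; under eq_comps_sum do rewrite drop0]].
  rewrite (sum_triangle (fun a b s => w (0 < a)%N (0 < b)%N *
    comps_sum i s (fun r => F (nonzero_part a ++ nonzero_part b ++ r)))).
  rewrite big_ord_recl /= subn0 big_ord_recl /= subn0.
  have -> : \sum_(b < n) w (0 < 0)%N (0 < bump 0 b)%N *
      comps_sum i (n - bump 0 b) (fun r => F (bump 0 b :: r)) =
      w false true * (\sum_(b < n) comps_sum i (n - b.+1) (fun r => F (b.+1 :: r))).
    by rewrite mulr_sumr.
  have -> : \sum_(a < n) \sum_(b < (n - bump 0 a).+1) w (0 < bump 0 a)%N (0 < b)%N *
      comps_sum i (n - bump 0 a - b) (fun r => F (bump 0 a :: nonzero_part b ++ r)) =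
      w true false * (\sum_(a < n) comps_sum i (n - a.+1) (fun r => F (a.+1 :: r)))
      + w true true * (\sum_(a < n) \sum_(b < n - a.+1)
          comps_sum i (n - a.+1 - b.+1) (fun r => F [:: a.+1, b.+1 & r])).
    rewrite !mulr_sumr -big_split; apply: eq_bigr => a _.
    by rewrite big_ord_recl subn0 mulr_sumr.
  rewrite mulrDl [RHS]addrC -[LHS]addrA; congr (_ + _).
  by rewrite [LHS]addrA [LHS]addrC.
rewrite (eq_bigr _ (fun (a : 'I__) _ => IH _ (fun c => F (a.+1 :: c)))).
rewrite big_ord_recr /= subnn addr0 !mulr_sumr -!big_split /=.
by apply: eq_bigr => a _; rewrite subSS -[(n - a)%N]prednK ?subn_gt0 // -subnS.
Qed.

End Compositions.

(** * Filling the holes *)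

Section HoleSum.

Variables (R : comNzRingType) (u1 u2 u3 u4 f g h t alpha beta p q : R).

(** Of the holes that do not contain the letter, j are on its left and j' on its
    right; A and B say whether its left and right neighbours are larger.  A peak with
    j = j' = 0 is the largest letter, whose weight is 1 because of the
    exponents lmax - 1, rmax - 1, lmaxpk - 1 and rmaxpk - 1. *)
Definition type_wt (j j' : nat) (A B : bool) : R :=
  match A, B with
  | true, true => u1 * u2
  | false, true => u3 * (if j == 0%N then alpha * t else 1)
  | true, false => u4 * (if j' == 0%N then beta * t else 1)
  | false, false =>
      if (j == 0%N) && (j' == 0%N) then 1
      else (if j == 0%N then alpha * f else 1) * (if j' == 0%N then beta * g else 1)
  end.

Definition gap_wt (j j' : nat) (A B : bool) : R :=
  h ^+ (j + j') * p ^+ j * q ^+ j' * type_wt j j' A B.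

Lemma gap_wt00 : gap_wt 0 0 false false = 1.
Proof. by rewrite /gap_wt /= !expr0 !mulr1. Qed.

(** Total weight of the ways to reveal n letters in holes of lengths c, letter
    by letter; a runs over what the revealed letter leaves on its left in its
    hole.  Emptied holes stay in the sequence as zeros but are not counted. *)
Fixpoint hole_sum (n : nat) (c : seq nat) : R :=
  if n is n'.+1 then
    cutsum (fun l m r => \sum_(a < m)
      gap_wt (count (leq 1) l) (count (leq 1) r) (0 < a)%N (0 < m.-1 - a)%N
      * hole_sum n' (l ++ (a : nat) :: (m.-1 - a)%N :: r)) c
  else 1.

Lemma hole_sum0 n l r : hole_sum n (l ++ 0%N :: r) = hole_sum n (l ++ r).
Proof.
elim: n l r => //= n IH l r.
rewrite !cutsum_cat /= big_ord0 add0r; congr (_ + _); apply: eq_cutsum => d m e _;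
  apply: eq_bigr => a _; rewrite ?count_cat /= ?add0n; congr (_ * _).
  by rewrite -!cat_cons !catA IH.
by rewrite -!catA /= IH.
Qed.

Lemma hole_sum_part n l a b r :
  hole_sum n (l ++ a :: b :: r) = hole_sum n (l ++ nonzero_part a ++ nonzero_part b ++ r).
Proof. by case: a b => [|a] [|b] //=; rewrite ?hole_sum0 // -cat_rcons hole_sum0 cat_rcons. Qed.

Lemma comps_sum_hole_sum k m n :
  comps_sum k.+1 m (hole_sum n.+1) = \sum_(j < k.+1) comps_sum k.+1 m (fun c =>
    split_part (gap_wt j (k - j)) (hole_sum n) (take j c) (nth 0%N c j) (drop j.+1 c)).
Proof.
rewrite -comps_sum_sum; apply: eq_comps_sum => c sc pc; rewrite /= (cutsumE 0%N) sc.
apply: eq_bigr => j _; apply: eq_bigr => a _; rewrite hole_sum_part.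
have nz d : all (leq 1) d -> count (leq 1) d = size d.
  by rewrite all_count => /eqP.
have [lt_j pd] : (j < size c)%N /\ all (leq 1) (take j c ++ drop j c).
  by rewrite cat_take_drop sc.
move: pd; rewrite (drop_nth 0%N lt_j) all_cat /= => /and3P[/nz -> _ /nz ->].
by rewrite size_take size_drop lt_j sc subSS.
Qed.

(** The two corrections at the ends j = 0 and j = k of the geometric sum are
    what separates [pqint3] from [pqint]. *)
Lemma gap_sum (x y : R) k :
  \sum_(j < k.+1) p ^+ j * q ^+ (k - j)
     * (1 + (j == 0%N :> nat)%:R * (x - 1) + (k - j == 0)%N%:R * (y - 1)) =
  pqint3 k.+1 y x p q.
Proof.
under eq_bigr do rewrite mulrDr mulrDr mulr1.
rewrite !big_split /= /pqint3 [RHS]addrC -addrA; congr (_ + _).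
  rewrite /pqint (reindex_inj rev_ord_inj); apply: eq_bigr => j _ /=.
  by rewrite subSS subKn // -ltnS.
rewrite addrC; congr (_ + _).
  rewrite big_ord_recr /= subnn eqxx expr0 mulr1 mul1r mulrC big1 ?add0r // => j _.
  by rewrite subn_eq0 leqNgt ltn_ord mul0r mulr0.
rewrite big_ord_recl /= subn0 expr0 !mul1r mulrC big1 ?addr0 // => j _.
by rewrite mul0r mulr0.
Qed.

Lemma valley_sum k :
  \sum_(j < k.+1) gap_wt j (k - j) true true = u1 * u2 * h ^+ k * pqint k.+1 p q.
Proof.
rewrite -pqint3_11 -gap_sum mulr_sumr; apply: eq_bigr => j _.
by rewrite /gap_wt /= (subnKC (leq_ord j)); ring.
Qed.

Lemma dasc_sum k :
  \sum_(j < k.+1) gap_wt j (k - j) false true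
  = h ^+ k * (u3 * pqint3 k.+1 1 (alpha * t) p q).
Proof.
rewrite -gap_sum !mulr_sumr; apply: eq_bigr => j _.
by rewrite /gap_wt /= (subnKC (leq_ord j)); case: eqP => _ /=; ring.
Qed.

Lemma ddes_sum k :
  \sum_(j < k.+1) gap_wt j (k - j) true false
  = h ^+ k * (u4 * pqint3 k.+1 (beta * t) 1 p q).
Proof.
rewrite -gap_sum !mulr_sumr; apply: eq_bigr => j _.
by rewrite /gap_wt /= (subnKC (leq_ord j)); case: (k - j == 0)%N => /=; ring.
Qed.

(** With at least two holes the ends j = 0 and j = k differ, so the exceptional
    weight of the largest letter does not occur. *)
Lemma peak_sum k :
  \sum_(j < k.+2) gap_wt j (k.+1 - j) false false
  = h ^+ k.+1 * pqint3 k.+2 (beta * g) (alpha * f) p q.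
Proof.
rewrite -gap_sum !mulr_sumr; apply: eq_bigr => j _.
rewrite /gap_wt /= (subnKC (leq_ord j)).
case: eqP => [->|_] /=; first by rewrite /=; ring.
by case: (_ - j == 0)%N => /=; ring.
Qed.

(** These totals over all hole lengths are the weights of the Motzkin paths of
    n - 1 steps from level k - 1 to level 0. *)
Definition filling_sum n k := comps_sum k n (hole_sum n).

(** The last coefficient is 1 at k = 0: only the largest letter closes the last
    hole. *)
Lemma filling_sum_rec n k :
  filling_sum n.+1 k.+1 =
    u1 * u2 * h ^+ k * pqint k.+1 p q * filling_sum n k.+2
  + h ^+ k * (u3 * pqint3 k.+1 1 (alpha * t) p q
              + u4 * pqint3 k.+1 (beta * t) 1 p q) * filling_sum n k.+1
  + (if k is 0 then 1 else h ^+ k * pqint3 k.+1 (beta * g) (alpha * f) p q) * filling_sum n k.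
Proof.
rewrite /filling_sum comps_sum_hole_sum mulrDr -valley_sum -dasc_sum -ddes_sum.
have -> : (if k is 0 then 1 else h ^+ k * pqint3 k.+1 (beta * g) (alpha * f) p q)
    = \sum_(j < k.+1) gap_wt j (k - j) false false.
  case: k => [|k]; last by rewrite peak_sum.
  by rewrite big_ord_recl big_ord0 gap_wt00 addr0.
rewrite -big_split !mulr_suml -!big_split /=; apply: eq_bigr => j _.
have := comps_sum_split (gap_wt j (k - j)) (hole_sum n) j (k - j) n.+1.
by rewrite !addnS subnKC // -ltnS.
Qed.

Lemma filling_sum_Jfrac n :
  filling_sum n.+1 1 = Jfrac
    (fun k => h ^+ k * (u3 * pqint3 k.+1 1 (alpha * t) p q
                        + u4 * pqint3 k.+1 (beta * t) 1 p q))
    (fun k => u1 * u2 * h ^+ (2 * k - 1)%N * pqint k p q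
              * pqint3 k.+1 (beta * g) (alpha * f) p q) n.
Proof.
pose L k := h ^+ k * pqint3 k.+1 (beta * g) (alpha * f) p q.
apply: (Jfrac_paths (mu := fun n k => filling_sum n.+1 k.+1) (L := L)
          (V := fun k => u1 * u2 * h ^+ k * pqint k.+1 p q)) => [k|k|m k].
- rewrite /L (_ : 2 * k.+1 - 1 = k + k.+1)%N ?exprD; last by lia.
  by ring.
- rewrite filling_sum_rec; case: k => [|k]; rewrite /filling_sum /= ?big_ord0; by ring.
- rewrite filling_sum_rec; congr (_ + _); case: k => [|k] //.
  by rewrite /filling_sum /= mul0r mulr0.
Qed.

End HoleSum.

(** * Statistics of a permutation, letter by letter *)

Section Statistics.

Local Arguments letter : simpl never.

Variables (n : nat) (s : 'S_n.+1).
Local Notation N := n.+1.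
Local Notation w := (letter s).

Definition left_drops (i : nat) : nat :=
  \sum_(1 <= k < i) ((w i < w k) && (w k.+1 < w i))%N.
Definition right_rises (i : nat) : nat :=
  \sum_(i.+1 <= k < N) ((w k < w i) && (w i < w k.+1))%N.

Lemma letter_gt0 i : (0 < i <= N)%N -> (0 < w i)%N.
Proof. by case: i => //= i lti; have := letterE s (Ordinal lti); rewrite /= => ->. Qed.

Lemma letter_neq i j : (0 < i <= N)%N -> i <> j -> w i <> w j.
Proof. by move=> /letter_gt0 pos nij /(letter_inj pos). Qed.

(** If some letter on the left is larger, then the left neighbour is, or the word
    drops across the letter in between. *)
Lemma is_lmaxE i : (0 < i <= N)%N ->
  is_lmax s i = (left_drops i == 0%N) && ~~ (w i < w i.-1)%N.
Proof.
move=> iN; apply/idP/andP => [/allP mx|[nodrop ndes]].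
  have lt_w k : (k < i)%N -> (w k < w i)%N.
    case: k => [|k] lt_k; first exact: letter_gt0.
    by apply: mx; rewrite mem_index_iota.
  split; last by rewrite -leqNgt ltnW // lt_w //; lia.
  rewrite /left_drops big_nat_cond big1 // => k /andP[/andP[_ /lt_w lt_k] _].
  by rewrite ltnNge ltnW.
have lt_w d k : (0 < k)%N -> (k + d.+1 = i)%N -> (w k < w i)%N.
  elim: d k => [|d IH] k k0 ek.
    have : w i <> w k by apply: letter_neq => //; lia.
    by move: ndes; rewrite (_ : i.-1 = k); lia.
  have ltk : (w k.+1 < w i)%N by apply: IH; lia.
  have nk : w i <> w k by apply: letter_neq => //; lia.
  move: nodrop; rewrite /left_drops sum_nat_seq_eq0 => /allP/(_ k).
  by rewrite mem_index_iota k0 /= => /(_ ltac:(lia)); lia.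
apply/allP => k; rewrite mem_index_iota => /andP[k0 ki].
by apply: (@lt_w (i - k).-1); lia.
Qed.

Lemma is_rmaxE i : (0 < i <= N)%N ->
  is_rmax s i = (right_rises i == 0%N) && ~~ (w i < w i.+1)%N.
Proof.
move=> iN; apply/idP/andP => [/allP mx|[norise nasc]].
  have lt_w k : (i < k <= N)%N -> (w k < w i)%N.
    by move=> lt_k; apply: mx; rewrite mem_index_iota ltnS.
  split.
    rewrite /right_rises big_nat_cond big1 // => k /andP[/andP[lo hi] _].
    by have := lt_w k.+1; lia.
  have [iltN|leNi] := ltnP i N; first by rewrite -leqNgt ltnW // lt_w //; lia.
  by rewrite (_ : i = N) ?[w N.+1]letter_out //; lia.
have lt_w d : (i + d.+1 <= N)%N -> (w (i + d.+1)%N < w i)%N.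
  elim: d => [|d IH] dN.
    have : w i <> w (i + 1)%N by apply: letter_neq => //; lia.
    by move: nasc; rewrite addn1; lia.
  have ltk := IH (ltac:(lia)).
  have nk : w i <> w (i + d.+2)%N by apply: letter_neq => //; lia.
  move: norise; rewrite /right_rises sum_nat_seq_eq0 => /allP/(_ (i + d.+1)%N).
  by rewrite mem_index_iota -addnS => /(_ ltac:(lia)) /=; lia.
apply/allP => k; rewrite mem_index_iota => /andP[k0 ki].
by have := @lt_w (k - i).-1; rewrite (_ : i + _ = k)%N; lia.
Qed.

Lemma sum_pairs m (F : nat -> nat -> nat) :
  (\sum_(1 <= i < m) \sum_(i.+1 <= j < m) F i j
   = \sum_(1 <= j < m) \sum_(1 <= i < j) F i j)%N.
Proof.
elim: m => [|[|m] IH]; first by rewrite !big_geq.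
  by rewrite !big_geq.
rewrite [LHS]big_nat_recr // [RHS]big_nat_recr //= -IH.
rewrite [X in (_ + X = _)%N]big_geq // addn0 -big_split /=.
by apply: eq_big_nat => i /andP[_ lt_i]; rewrite big_nat_recr.
Qed.

Lemma stat_31_2E : stat_31_2 s = (\sum_(1 <= i < N.+1) left_drops i)%N.
Proof. exact: sum_pairs. Qed.

Lemma stat_2_13E : stat_2_13 s = (\sum_(1 <= i < N.+1) right_rises i)%N.
Proof.
rewrite /stat_2_13 -[LHS](sum_pairs N (fun i j => (w j < w i < w j.+1)%N : nat)).
by rewrite [RHS]big_nat_recr //= /right_rises [X in (_ + X)%N]big_geq ?addn0.
Qed.

Lemma sum_letters (F : nat -> nat) :
  (\sum_(1 <= i < N.+1) F (w i) = \sum_(1 <= v < N.+1) F v)%N.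
Proof.
rewrite !big_add1 !big_mkord [RHS](reindex_inj (@perm_inj _ s)).
by apply: eq_bigr => i _; rewrite letterE.
Qed.

Lemma rises_minus_drops (P : pred nat) i : ~~ P 0%N ->
  (\sum_(0 <= k < i) (~~ P k && P k.+1) = P i + \sum_(0 <= k < i) (P k && ~~ P k.+1))%N.
Proof.
move=> P0; elim: i => [|i IH]; first by rewrite !big_geq // (negbTE P0).
by rewrite !big_nat_recr //= IH; case: (P i); case: (P i.+1); lia.
Qed.

(** The word starts below the letter and has risen to it at position i, so on
    the left of i there is one rise to its level more than there are drops. *)
Lemma straddling_ascents i : (0 < i <= N)%N ->
  (\sum_(0 <= k < N) ((w k < w i) && (w i <= w k.+1))
   = (left_drops i + right_rises i).+1)%N.
Proof.
move=> iN; have wi := letter_gt0 iN.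
have neq k : k <> i -> w i <> w k by move=> nk; apply: letter_neq => //; lia.
rewrite (big_cat_nat _ (n := i)) //=; last by lia.
have -> : (\sum_(0 <= k < i) ((w k < w i) && (w i <= w k.+1)) = (left_drops i).+1)%N.
  transitivity (\sum_(0 <= k < i) (~~ (w i <= w k) && (w i <= w k.+1)))%N.
    by apply: eq_bigr => k _; rewrite ltnNge.
  rewrite (rises_minus_drops (P := fun k => (w i <= w k)%N)) -?ltnNge // leqnn add1n.
  congr S; rewrite /left_drops big_ltn; last by lia.
  rewrite leqNgt wi add0n; apply: eq_big_nat => k /andP[_ ltki].
  by rewrite leq_eqVlt (introF eqP) ?ltnNge //=; apply: neq; lia.
rewrite addSn; congr (_ + _).+1.
have [iltN|leNi] := ltnP i N; last first.
  by rewrite /right_rises !big_geq //; lia.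
rewrite big_ltn // ltnn add0n; apply: eq_big_nat => k /andP[ltik _].
by have := neq k.+1; lia.
Qed.

Lemma sum_interval lo hi m : (hi <= m)%N ->
  (\sum_(1 <= v < m.+1) ((lo < v) && (v <= hi)) = hi - lo)%N.
Proof.
elim: m hi => [|m IH] hi le_hi; first by rewrite big_geq //; lia.
rewrite big_nat_recr //=.
have [le_m|] := leqP hi m.
  by rewrite IH //; lia.
move=> lt_m; have -> : hi = m.+1 by lia.
have -> : (\sum_(1 <= v < m.+1) ((lo < v) && (v <= m.+1)) = m - lo)%N; last by lia.
rewrite -IH //; apply: eq_big_nat => v /andP[_ lt_v].
by congr (_ && _ : nat); lia.
Qed.

(** Both sides count the pairs of an ascent and a letter that it crosses or
    reaches; the truncated difference is the height of an ascent. *)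
Lemma sum_straddling :
  (\sum_(1 <= i < N.+1) (left_drops i + right_rises i) + N
   = \sum_(0 <= k < N) (w k.+1 - w k))%N.
Proof.
have -> : (\sum_(1 <= i < N.+1) (left_drops i + right_rises i) + N =
    \sum_(1 <= i < N.+1) \sum_(0 <= k < N) ((w k < w i) && (w i <= w k.+1)))%N.
  transitivity (\sum_(1 <= i < N.+1) (left_drops i + right_rises i + 1))%N.
    by rewrite [RHS]big_split /= sum_nat_const_nat subSS subn0 muln1.
  by apply: eq_big_nat => i iN; rewrite straddling_ascents ?addn1.
rewrite exchange_big_nat; apply: eq_bigr => k _ /=.
rewrite (sum_letters (fun v => ((w k < v) && (v <= w k.+1))%N : nat)).
by rewrite sum_interval // letter_le.
Qed.

(** Summation by parts: the bracket is 1 at peaks, -1 at valleys and 0 elsewhere. *)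
Lemma abel_ascents k :
  \sum_(1 <= i < k.+1) (w i)%:Z * ((w i.-1 < w i)%:Z - (w i < w i.+1)%:Z) =
  (\sum_(0 <= i < k) (w i.+1 - w i)%N)%:Z - (w k < w k.+1)%:Z * (w k)%:Z.
Proof.
elim: k => [|k IH]; first by rewrite !big_geq // mulr0.
by rewrite big_nat_recr //= IH [in RHS]big_nat_recr //=; case: (ltngtP (w k) (w k.+1)); lia.
Qed.

Lemma D_statE : `|D_stat s|%N = (\sum_(1 <= i < N.+1) (left_drops i + right_rises i))%N.
Proof.
suff -> : D_stat s = (\sum_(1 <= i < N.+1) (left_drops i + right_rises i))%N%:Z by [].
have [m [m0 mN sm]] := letter_max_ex s.
case/and3P: (letter_max_peak m0 sm) => pm _ _.
have pN : \sum_(1 <= i < N.+1 | is_peak s i) (w i)%:Z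
   = N%:Z + \sum_(1 <= i < N.+1 | is_peak s i && (w i != N)) (w i)%:Z.
  rewrite (bigID (fun i => w i == N)) /=; congr (_ + _).
  rewrite (eq_bigl (pred1 m)) => [|i]; first by rewrite big_nat1_eq m0 mN sm.
  apply/andP/eqP => [[_ /eqP si]|->]; last by rewrite pm sm.
  by apply: (@letter_inj _ s) => //; rewrite si.
apply: (addrI N%:Z); rewrite /D_stat addrA -pN.
rewrite -PoszD addnC sum_straddling.
have := abel_ascents N; rewrite letter_out mul0r subr0 => <-.
rewrite big_mkcond [X in (_ - X)]big_mkcond -sumrB /=.
apply: eq_big_nat => i iN.
have d1 : w i <> w i.-1 by apply: letter_neq; lia.
have d2 : w i <> w i.+1 by apply: letter_neq; lia.
rewrite /is_peak /is_valley.
by case: (ltngtP (w i) (w i.-1)) d1 => // _ _; case: (ltngtP (w i) (w i.+1)) d2 => // _ _ /=; ring.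
Qed.

End Statistics.

Section PermutationWeight.

Variables (R : comNzRingType) (u1 u2 u3 u4 f g h t alpha beta p q : R).
Variables (n : nat) (s : 'S_n.+1).

Local Arguments letter : simpl never.
Local Notation w := (letter s).
Local Notation gap_wt := (gap_wt u1 u2 u3 u4 f g h t alpha beta p q).

Lemma npos_split (P : pred nat) m : (0 < m < n.+2)%N ->
  npos n.+1 P = (P m + \sum_(1 <= i < n.+2 | i != m) P i)%N.
Proof.
move=> mN; rewrite /npos -sum1_count big_mkcond.
rewrite (eq_bigr (fun i => P i : nat)) => [|i _]; last by case: (P i).
by rewrite (bigD1_seq m) ?mem_index_iota ?iota_uniq.
Qed.

Lemma lmax_rmax_max i : is_lmax s i -> is_rmax s i -> (0 < i)%N -> w i = n.+1.
Proof.
move=> /allP lm /allP rm i0; have [m [m0 mN sm]] := letter_max_ex s.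
have [mi|im|<-//] := ltngtP m i.
  by have := lm m; rewrite mem_index_iota sm m0 => /(_ mi); have := letter_le s i; lia.
have := rm m; rewrite mem_index_iota sm im mN => /(_ isT).
by have := letter_le s i; lia.
Qed.

(** The largest letter m is split off: it accounts for every - 1 in the exponents,
    for the missing term of D, and has local weight 1.  At the other positions
    the two sides agree factor by factor, by cases on the type and on j = 0,
    j' = 0. *)
Lemma perm_wt_prod :
  (u1 * u2) ^+ val_stat s * u3 ^+ da_stat s * u4 ^+ dd_stat s
    * alpha ^+ (lmax_stat s).-1 * beta ^+ (rmax_stat s).-1
    * f ^+ (lmaxpk_stat s).-1 * g ^+ (rmaxpk_stat s).-1
    * t ^+ (lmaxda_stat s + rmaxdd_stat s)
    * h ^+ `|D_stat s|%N * p ^+ stat_31_2 s * q ^+ stat_2_13 s =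
  \prod_(1 <= i < n.+2) gap_wt (left_drops s i) (right_rises s i)
                               (w i < w i.-1)%N (w i < w i.+1)%N.
Proof.
have [m [m0 mN sm]] := letter_max_ex s.
have mN' : (0 < m < n.+2)%N by rewrite m0.
have /and3P[pm lm rm] := letter_max_peak m0 sm.
have /andP[/eqP dm nm] : (left_drops s m == 0%N) && ~~ (w m < w m.-1)%N by rewrite -is_lmaxE.
have /andP[/eqP em nm'] : (right_rises s m == 0%N) && ~~ (w m < w m.+1)%N by rewrite -is_rmaxE.
have sumD1 (E : nat -> nat) : E m = 0%N ->
    (\sum_(1 <= i < n.+2) E i = \sum_(1 <= i < n.+2 | i != m) E i)%N.
  by move=> Em; rewrite (bigD1_seq m) ?mem_index_iota ?iota_uniq //= Em.
rewrite [RHS](bigD1_seq m) ?mem_index_iota ?iota_uniq //.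
rewrite dm em (negbTE nm) (negbTE nm') gap_wt00 [RHS]mul1r.
rewrite D_statE stat_31_2E stat_2_13E !sumD1 ?dm ?em //.
have [vm am bm] : [/\ is_valley s m = false, is_dasc s m = false & is_ddes s m = false].
  by split; rewrite /is_valley /is_dasc /is_ddes ?(negbTE nm) ?(negbTE nm') ?andbF.
rewrite /val_stat /da_stat /dd_stat /lmax_stat /rmax_stat /lmaxpk_stat /rmaxpk_stat.
rewrite /lmaxda_stat /rmaxdd_stat !(npos_split _ mN') /= lm rm pm vm am bm /=.
rewrite ?add0n ?add1n /= -big_split -!prodrXr -!big_split /=.
rewrite [LHS]big_seq_cond [RHS]big_seq_cond; apply: eq_bigr => i.
rewrite mem_index_iota => /andP[iN nim].
have d1 : w i <> w i.-1 by apply: letter_neq; lia.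
have d2 : w i <> w i.+1 by apply: letter_neq; lia.
have nmax : ~~ [&& is_lmax s i & is_rmax s i].
  apply/negP => /andP[li ri]; move/eqP: nim; apply.
  apply: (@letter_inj _ s); first by apply: letter_gt0; lia.
  by rewrite sm lmax_rmax_max //; lia.
move: nmax; rewrite !is_lmaxE // !is_rmaxE // /gap_wt /type_wt.
rewrite /is_valley /is_dasc /is_ddes /is_peak.
case: (ltngtP (w i) (w i.-1)) d1 => // _ _; case: (ltngtP (w i) (w i.+1)) d2 => // _ _ /=;
  case: (left_drops s i == 0%N); case: (right_rises s i == 0%N) => //= _; ring.
Qed.

End PermutationWeight.

(** * Permutations as orders of emptying positions *)

Section Thresholds.

Variables (R : comNzRingType) (u1 u2 u3 u4 f g h t alpha beta p q : R).
Local Arguments letter : simpl never.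
Local Notation gap_wt := (gap_wt u1 u2 u3 u4 f g h t alpha beta p q).
Local Notation hole_sum := (hole_sum u1 u2 u3 u4 f g h t alpha beta p q).

(** The default for the letter after the last one is chosen so that the end of
    the word is neither a drop nor a rise: the left word ends next to the letter
    itself, the right word at the final 0. *)
Fixpoint drops (B : bitseq) : nat :=
  if B is x :: B' then ((x && ~~ head true B') + drops B')%N else 0.
Fixpoint rises (B : bitseq) : nat :=
  if B is x :: B' then ((~~ x && head false B') + rises B')%N else 0.

Definition bit_wt (l r : bitseq) : R :=
  gap_wt (drops l) (rises r) (last false l) (head false r).

(** [hole_sum] with the holes drawn as runs of [true] in a word of positions. *)
Fixpoint bit_sum (n : nat) (B : bitseq) : R :=
  if n is n'.+1 then
    cutsum (fun l x r => if x then bit_wt l r * bit_sum n' (l ++ false :: r) else 0) B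
  else 1.

Definition hole_bits (c : seq nat) : bitseq := flatten [seq rcons (nseq m true) false | m <- c].

Lemma hole_bits_cons m c : hole_bits (m :: c) = nseq m true ++ false :: hole_bits c.
Proof. exact: cat_rcons. Qed.

Lemma hole_bits1 m : hole_bits [:: m] = rcons (nseq m true) false.
Proof. exact: cats0. Qed.

Lemma hole_bits_cat c d : hole_bits (c ++ d) = hole_bits c ++ hole_bits d.
Proof. by rewrite /hole_bits map_cat flatten_cat. Qed.

Lemma cutsum_hole_bits (G : bitseq -> bitseq -> R) c :
  cutsum (fun l (x : bool) r => if x then G l r else 0) (hole_bits c) =
  cutsum (fun l m r => \sum_(a < m)
    G (hole_bits l ++ nseq a true) (nseq (m.-1 - a) true ++ false :: hole_bits r)) c.
Proof.
elim: c G => // m c IH G; rewrite hole_bits_cons cutsum_cat /= add0r; congr (_ + _).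
  rewrite (cutsumE true) size_nseq; apply: eq_bigr => a _.
  by rewrite nth_nseq ltn_ord take_nseq 1?ltnW // drop_nseq -subn1 -subnDA.
rewrite (IH (fun l r => G (nseq m true ++ false :: l) r)).
by apply: eq_cutsum => l k r _; apply: eq_bigr => a _; rewrite hole_bits_cons -catA.
Qed.

Lemma drops_bits c a : drops (hole_bits c ++ nseq a true) = count (leq 1) c.
Proof.
elim: c => [|m c IH] /=; first by elim: a => //= a ->; case: a.
rewrite hole_bits_cons -catA -IH; case: m => [|m] //=.
by elim: m => //= m <-; case: (m).
Qed.

Lemma rises_bits b c : rises (nseq b true ++ false :: hole_bits c) = count (leq 1) c.
Proof.
have skip k B : rises (nseq k true ++ B) = rises B by elim: k.
rewrite skip; elim: c => // m c IH; rewrite hole_bits_cons.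
by case: m => [|m]; rewrite -[RHS]/(_ + count _ _)%N -IH //= skip.
Qed.

Lemma bit_wt_bits l r a b :
  bit_wt (hole_bits l ++ nseq a true) (nseq b true ++ false :: hole_bits r)
  = gap_wt (count (leq 1) l) (count (leq 1) r) (0 < a)%N (0 < b)%N.
Proof.
rewrite /bit_wt drops_bits rises_bits; congr (gap_wt _ _ _ _); last by case: b.
rewrite last_cat; have -> : last false (hole_bits l) = false; last by case: a => //=; elim.
by elim/last_ind: l => //= l m _; rewrite -cats1 hole_bits_cat hole_bits_cons last_cat last_cat.
Qed.

Lemma bit_sum_bits n c : bit_sum n (hole_bits c) = hole_sum n c.
Proof.
elim: n c => //= n IH c.
rewrite (cutsum_hole_bits (fun l r => bit_wt l r * bit_sum n (l ++ false :: r))).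
apply: eq_cutsum => l m r _; apply: eq_bigr => a _; rewrite bit_wt_bits -IH.
congr (_ * bit_sum n _).
by rewrite hole_bits_cat !hole_bits_cons -catA.
Qed.

Definition clear_bit (i : nat) (B : bitseq) : bitseq := take i B ++ false :: drop i.+1 B.

Fixpoint emptying_wt (B : bitseq) (w : seq nat) : R :=
  if w is i :: w' then bit_wt (take i B) (drop i.+1 B) * emptying_wt (clear_bit i B) w' else 1.

Definition positions (B : bitseq) : seq nat := [seq i <- iota 0 (size B) | nth false B i].

Lemma size_clear i B : (i < size B)%N -> size (clear_bit i B) = size B.
Proof. by move=> lti; rewrite size_cat /= size_drop size_take lti; lia. Qed.

Lemma nth_clear i j B : (i < size B)%N -> nth false (clear_bit i B) j = (j != i) && nth false B j.
Proof.
move=> lti; rewrite nth_cat size_take lti; case: (ltngtP j i) => [ltj|ltj|->] /=.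
- by rewrite nth_take.
- by rewrite -[(j - i)%N]prednK ?subn_gt0 //= nth_drop; congr nth; lia.
- by rewrite subnn.
Qed.

Lemma positions_clear i B : (i < size B)%N -> positions (clear_bit i B) = rem i (positions B).
Proof.
move=> lti; rewrite rem_filter ?filter_uniq ?iota_uniq // -filter_predI /positions size_clear //.
by apply: eq_filter => j; rewrite nth_clear.
Qed.

(** Choosing the first position of the order and then the rest is the recursion
    of both sides. *)
Lemma sum_permutations_positions n B : size (positions B) = n ->
  \sum_(w <- permutations (positions B)) emptying_wt B w = bit_sum n B.
Proof.
elim: n B => [|n IH] B sz.
  by rewrite (size0nil sz) /= big_seq1.
rewrite (perm_big _ (permutationsE _)) ?sz // big_allpairs_dep /=.
rewrite undup_id ?filter_uniq ?iota_uniq // big_filter (cutsumE false) big_mkcond /=.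
have -> : iota 0 (size B) = index_iota 0 (size B) by rewrite /index_iota subn0.
rewrite big_mkord; apply: eq_bigr => i _.
case: ifP => // Bi; rewrite -mulr_sumr; congr (_ * _).
rewrite -positions_clear // IH // positions_clear // size_rem ?sz //.
by rewrite mem_filter Bi mem_iota /=.
Qed.

Lemma positions_bits1 N : positions (hole_bits [:: N]) = iota 0 N.
Proof.
rewrite /positions hole_bits1 size_rcons size_nseq -addn1 iotaD filter_cat /= nth_rcons.
rewrite size_nseq ltnn eqxx cats0; apply/all_filterP/allP => i.
by rewrite mem_iota nth_rcons size_nseq nth_nseq => /= ->.
Qed.

Section Permutation.

Variables (n : nat) (s : 'S_n.+1).
Local Notation N := n.+1.

(** The inverse permutation as a word, which is the order in which the positions
    are emptied. *)
Definition pos_word : seq nat := [seq nat_of_ord ((s^-1)%g x) | x <- enum 'I_N].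

Lemma size_pos_word : size pos_word = N.
Proof. by rewrite size_map size_enum_ord. Qed.

Lemma nth_pos_word (x : 'I_N) : nth 0%N pos_word x = (s^-1)%g x.
Proof. by rewrite (nth_map x) ?size_enum_ord // nth_ord_enum. Qed.

(** Position N, behind the last letter, is kept as a final [false], so that above
    threshold 0 this is a single hole of length N. *)
Definition above_bits (m : nat) : bitseq := [seq (m < letter s i.+1)%N | i <- iota 0 N.+1].

Lemma above_bits0 : above_bits 0 = hole_bits [:: N].
Proof.
rewrite hole_bits1; apply: (@eq_from_nth _ false) => [|i].
  by rewrite size_map size_iota size_rcons size_nseq.
rewrite size_map size_iota => lti.
rewrite (nth_map 0%N) ?size_iota // nth_iota // add0n nth_rcons size_nseq nth_nseq.
case: (ltngtP i N) => [lt_i|lt_i|->]; [by rewrite letter_gt0|lia|by rewrite letter_out].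
Qed.

Lemma nth_above_bits m i : nth false (above_bits m) i = (m < letter s i.+1)%N.
Proof.
have [lti|lei] := ltnP i N.+1.
  by rewrite (nth_map 0%N) ?size_iota // nth_iota.
rewrite nth_default ?size_map ?size_iota //.
by rewrite /letter insubF //; lia.
Qed.

Lemma clear_above_bits (x : 'I_N) : clear_bit ((s^-1)%g x) (above_bits x) = above_bits x.+1.
Proof.
have ltx : ((s^-1)%g x < size (above_bits x))%N.
  by rewrite size_map size_iota ltnS ltnW.
apply: (@eq_from_nth _ false); first by rewrite size_clear // !size_map.
move=> i _; rewrite nth_clear // !nth_above_bits.
have lx : letter s ((s^-1)%g x).+1 = x.+1 by rewrite letterE permKV.
case: eqP => [->|ni] /=; first by rewrite lx ltnn.
have : letter s i.+1 <> x.+1.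
  by move=> e; apply: ni; apply: succn_inj; apply: (@letter_inj _ s); rewrite e ?lx.
lia.
Qed.

Lemma emptying_wt_pos_word :
  emptying_wt (hole_bits [:: N]) pos_word =
  \prod_(x < N) bit_wt (take ((s^-1)%g x) (above_bits x)) (drop ((s^-1)%g x).+1 (above_bits x)).
Proof.
have gen k m : (k + m = N)%N -> emptying_wt (above_bits m) (drop m pos_word) =
    \prod_(x < N | (m <= x)%N)
      bit_wt (take ((s^-1)%g x) (above_bits x)) (drop ((s^-1)%g x).+1 (above_bits x)).
  elim: k m => [|k IH] m km.
    rewrite drop_oversize /= ?big_pred0 // => [x|]; first by have := ltn_ord x; lia.
    by rewrite size_pos_word; lia.
  have ltm : (m < N)%N by lia.
  have wm := nth_pos_word (Ordinal ltm).
  rewrite (drop_nth 0%N) ?size_pos_word // (bigD1 (Ordinal ltm)) //= wm.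
  congr (_ * _); rewrite -[m in clear_bit _ (above_bits m)]/(val (Ordinal ltm)) clear_above_bits.
  rewrite IH /=; last by lia.
  by apply: eq_bigl => x; rewrite -val_eqE /= ltn_neqAle andbC eq_sym.
by rewrite -above_bits0 -[pos_word]drop0 (gen N) ?addn0.
Qed.

Lemma drops_map_iota (P : pred nat) m k : P (m + k)%N ->
  drops (map P (iota m k)) = (\sum_(m <= x < m + k) (P x && ~~ P x.+1))%N.
Proof.
elim: k m => [|k IH] m Pk; first by rewrite big_geq ?addn0.
rewrite big_ltn /= ?IH -?addSnnS ?addSnnS //; last by lia.
by case: k Pk {IH} => [|k] //=; rewrite addn1 => ->.
Qed.

Lemma rises_map_iota (P : pred nat) m k : ~~ P (m + k)%N ->
  rises (map P (iota m k)) = (\sum_(m <= x < m + k) (~~ P x && P x.+1))%N.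
Proof.
elim: k m => [|k IH] m Pk; first by rewrite big_geq ?addn0.
rewrite big_ltn /= ?IH -?addSnnS ?addSnnS //; last by lia.
by case: k Pk {IH} => [|k] //=; rewrite addn1 => /negbTE ->; rewrite andbF.
Qed.

Lemma bit_wt_above (i : 'I_N) :
  bit_wt (take i (above_bits (s i))) (drop i.+1 (above_bits (s i))) =
  gap_wt (left_drops s i.+1) (right_rises s i.+1)
    (letter s i.+1 < letter s i)%N (letter s i.+1 < letter s i.+2)%N.
Proof.
pose P k := (letter s i.+1 <= letter s k.+1)%N.
have lti := ltn_ord i.
have neq k : k <> i.+1 -> letter s i.+1 <> letter s k.
  by move=> nk; apply: letter_neq; lia.
have out k : (N <= k)%N -> letter s k.+1 = 0%N by move=> leNk; rewrite /letter insubF //; lia.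
have eN : (i.+1 + (N - i) = N.+1)%N by lia.
have aboveE : above_bits (s i) = map P (iota 0 i) ++ true :: map P (iota i.+1 (N - i)).
  have -> : above_bits (s i) = map P (iota 0 N.+1).
    by apply: eq_map => k; rewrite /P letterE.
  have -> : N.+1 = (i + (N - i).+1)%N by lia.
  by rewrite iotaD map_cat /= {2}/P leqnn.
have szi : size (map P (iota 0 i)) = i by rewrite size_map size_iota.
rewrite aboveE take_size_cat // -cat_rcons drop_size_cat ?size_rcons ?szi //.
rewrite /bit_wt drops_map_iota ?rises_map_iota ?add0n; last 2 first.
- by rewrite eN /P (out N.+1) // -ltnNge letter_gt0.
- by rewrite /P leqnn.
congr (gap_wt _ _ _ _).
- rewrite /left_drops big_add1; apply: eq_big_nat => k kN.
  by have := neq k.+1; rewrite /P; lia.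
- have leN : (N <= N.+2)%N by lia.
  rewrite /right_rises (big_nat_widen _ _ _ _ _ leN) [RHS]big_mkcond [RHS]big_add1 /=.
  rewrite eN; apply: eq_big_nat => k /andP[lk kN].
  have := neq k.+1; have := neq k.+2; rewrite /P; case: ltnP => [_|leNk]; first by lia.
  by rewrite (out k.+1) //; have := @letter_gt0 _ s i.+1; lia.
- have : forall j : nat, j = i -> last false (map P (iota 0 j)) = (letter s i.+1 < letter s j)%N.
    case=> [|j] ji //; rewrite -{1}addn1 iotaD map_cat last_cat /= /P add0n.
    by rewrite leq_eqVlt; have /eqP/negbTE -> : letter s i.+1 <> letter s j.+1 by apply: neq; lia.
  by apply.
- rewrite -[(N - i)%N]prednK ?subn_gt0 //= /P leq_eqVlt.
  by have /eqP/negbTE -> : letter s i.+1 <> letter s i.+2 by apply: neq; lia.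
Qed.

End Permutation.

Lemma perm_eq_pos_words n :
  perm_eq [seq pos_word s | s <- enum {: 'S_n.+1}] (permutations (iota 0 n.+1)).
Proof.
have inj : injective (@pos_word n).
  move=> s s' e; apply: invg_inj; apply/permP => x; apply: val_inj.
  by have := congr1 (fun w => nth 0%N w x) e; rewrite !nth_pos_word.
have un : uniq [seq pos_word s | s <- enum {: 'S_n.+1}] by rewrite map_inj_uniq ?enum_uniq.
(* Both lists are duplicate-free and have N! entries, so one inclusion suffices. *)
have sub : {subset [seq pos_word s | s <- enum {: 'S_n.+1}] <= permutations (iota 0 n.+1)}.
  move=> _ /mapP[s _ ->]; rewrite mem_permutations.
  rewrite uniq_perm ?iota_uniq //.
    rewrite map_inj_uniq ?enum_uniq //; apply: inj_comp => //; [exact: val_inj|exact: perm_inj].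
  move=> k; rewrite mem_iota /=; apply/mapP/idP => [[x _ ->] //|ltk].
  by exists (s (Ordinal ltk)); rewrite ?mem_enum // permK.
apply: uniq_perm; rewrite ?permutations_uniq //; apply: (uniq_min_size un sub _).2.
by rewrite size_permutations ?iota_uniq // size_iota size_map -cardE card_Sn.
Qed.

(** All letters are hidden in one hole, and a permutation is the order in which
    its positions are emptied. *)
Lemma A_polyE n :
  A_poly u1 u2 u3 u4 f g h t alpha beta p q n = hole_sum n.+1 [:: n.+1].
Proof.
rewrite -bit_sum_bits -sum_permutations_positions; last by rewrite positions_bits1 size_iota.
rewrite positions_bits1 -(perm_big _ (perm_eq_pos_words n)) big_map big_enum /=.
apply: eq_bigr => s _; rewrite perm_wt_prod emptying_wt_pos_word.
rewrite [RHS](reindex_inj (@perm_inj _ s)) big_add1 big_mkord.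
by apply: eq_bigr => i _; rewrite permK bit_wt_above.
Qed.

End Thresholds.

Theorem theorem2p1 (R : comNzRingType)
    (u1 u2 u3 u4 f g h t alpha beta p q : R) :
  A_poly u1 u2 u3 u4 f g h t alpha beta p q =1
  Jfrac
    (fun k : nat =>
       h ^+ k * (u3 * pqint3 k.+1 1 (alpha * t) p q
                 + u4 * pqint3 k.+1 (beta * t) 1 p q))
    (fun k : nat =>
       u1 * u2 * h ^+ (2 * k - 1)%N * pqint k p q
       * pqint3 k.+1 (beta * g) (alpha * f) p q).
Proof.
by move=> n; rewrite -filling_sum_Jfrac A_polyE /filling_sum comps_sum1.
Qed.
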